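(* Let $\lambda$ be a partition of $n$. Then the Schur function $s_\lambda$ is F-multiplicity free if and only if $\lambda$ or its transpose $\lambda^t$ is one of the following: (i) $(3,3)$ if $n=6$; (ii) $(4,4)$ if $n=8$; (iii) $(n-2,2)$ if $n\geq 4$; (iv) $(n-k,1^k)$ if $n\geq 1$ and $0\leq k\leq n-1$.
   Context: A composition $\alpha=(\alpha_1,\dots,\alpha_k)$ of $n$ (written $\alpha\vDash n$) is a list of positive integers summing to $n$; $i^m$ denotes $m$ consecutive parts equal to $i$. Compositions of $n$ are in bijection with subsets of $[n-1]=\{1,\dots,n-1\}$ via $\mathrm{set}(\alpha)=\{\alpha_1,\alpha_1+\alpha_2,\dots,\alpha_1+\cdots+\alpha_{k-1}\}$. The fundamental quasisymmetric function is $F_\alpha=\sum x_{i_1}x_{i_2}\cdots x_{i_n}$, the sum over all $i_1\le i_2\le\cdots\le i_n$ of positive integers with $i_j<i_{j+1}$ whenever $j\in\mathrm{set}(\alpha)$. The Young diagram of a partition has $\lambda_i$ left-justified cells in row $i$ (rows numbered top to bottom); $\lambda^t$ is the transpose (conjugate) partition. A standard Young tableau (SYT) of shape $\lambda$, $|\lambda|=n$, is a filling of the cells with $1,\dots,n$, each once, increasing along rows left to right and down columns. Its descent set is the set of $i$ such that $i+1$ lies in a row strictly lower than $i$; $\mathrm{com}(T)$ is the composition whose set is this descent set. The Schur function is $s_\lambda=\sum_T F_{\mathrm{com}(T)}$, the sum over all SYT $T$ of shape $\lambda$. A quasisymmetric function $\sum_\alpha c_\alpha F_\alpha$ is called F-multiplicity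 free if every coefficient $c_\alpha$ is $0$ or $1$. *)

(* Defs.v *)
From mathcomp Require Import all_boot all_algebra.
From mathcomp Require Import finmap multiset.

Set Implicit Arguments.
Unset Strict Implicit.
Unset Printing Implicit Defensive.

Definition is_composition (a : seq nat) : bool := all (leq 1) a.

(* set(a) = {a_1, a_1 + a_2, ..., a_1 + ... + a_(k-1)}, in increasing order. *)
Definition comp_set (a : seq nat) : seq nat :=
  [seq sumn (take i a) | i <- iota 1 (size a).-1].

(* The composition of n whose set is D, for D an increasing list of elements
   of [n-1]: the successive differences of 0, D_1, ..., D_r, n. *)
Definition comp_of_set (n : nat) (D : seq nat) : seq nat :=
  pairmap (fun x y => y - x) 0 (rcons D n).

Section CompOfSet.

Let sub_pairmap := pairmap (fun x y : nat => y - x).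

Let sum_take_pairmap (x : nat) (s : seq nat) (i : nat) :
  path ltn x s -> i < size s -> x + sumn (take i.+1 (sub_pairmap x s)) = nth 0 s i.
Proof.
elim: s x i => [//|y s IHs] x [|i] /= /andP[lt_xy s_inc] lt_is.
  by rewrite take0 addn0 subnKC // ltnW.
by rewrite addnA subnKC ?IHs // ltnW.
Qed.

Let pairmap_gt0 (x : nat) (s : seq nat) :
  path ltn x s -> all (leq 1) (sub_pairmap x s).
Proof.
elim: s x => //= y s IHs x /andP[lt_xy /IHs ->].
by rewrite subn_gt0 lt_xy.
Qed.

Lemma comp_of_set_composition (n : nat) (D : seq nat) :
  path ltn 0 (rcons D n) -> is_composition (comp_of_set n D).
Proof. exact: pairmap_gt0. Qed.

Lemma sumn_comp_of_set (n : nat) (D : seq nat) :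
  path ltn 0 (rcons D n) -> sumn (comp_of_set n D) = n.
Proof.
move=> D_inc; have lt_D : size D < size (rcons D n) by rewrite size_rcons.
have := sum_take_pairmap D_inc lt_D.
by rewrite nth_rcons ltnn eqxx add0n take_oversize // size_pairmap size_rcons.
Qed.

Lemma comp_of_setK (n : nat) (D : seq nat) :
  path ltn 0 (rcons D n) -> comp_set (comp_of_set n D) = D.
Proof.
move=> D_inc; rewrite /comp_set size_pairmap size_rcons /=.
apply: (@eq_from_nth _ 0) => [|i]; rewrite size_map size_iota // => lt_iD.
rewrite (nth_map 0) ?size_iota // nth_iota // add1n -[LHS]add0n.
by rewrite sum_take_pairmap ?size_rcons ?ltnS ?(ltnW lt_iD) // nth_rcons lt_iD.
Qed.

End CompOfSet.

(* Formal power series with integer coefficients in x_0, x_1, x_2, ...: the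
   monomial x_{i_1} ... x_{i_d} is the multiset {i_1, ..., i_d}, and a series
   maps each monomial to its coefficient.  The variable x_0 is never used. *)
Definition series : Type := {mset nat}%mset -> int.

(* s = (i_1, ..., i_n), so that i_j is [nth 0 s j.-1]. *)
Definition admissible (a s : seq nat) : bool :=
  [&& size s == sumn a, all (leq 1) s, sorted leq s
    & all (fun j => nth 0 s j.-1 < nth 0 s j) (comp_set a)].

(* [permutations m] lists, without repetition, the sequences (i_1, ..., i_d)
   such that x_{i_1} ... x_{i_d} is the monomial m. *)
Definition fundamental (a : seq nat) : series :=
  fun m => Posz (count (admissible a) (permutations m)).

Definition F_multiplicity_free (f : series) : Prop :=
  exists c : {fsfun seq nat -> int with 0%R},
    [/\ forall a, a \in finsupp c -> is_composition a,
        forall m, f m = (\sum_(a <- finsupp c) c a * fundamental a m)%R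
      & forall a, c a = 0%R \/ c a = 1%R].

Definition is_partition_of (n : nat) (la : seq nat) : bool :=
  [&& sorted geq la, all (leq 1) la & sumn la == n].

Definition transpose (la : seq nat) : seq nat :=
  [seq count (ltn j) la | j <- iota 0 (head 0 la)].

Lemma transpose_diagram (la : seq nat) (i j : nat) :
  sorted geq la -> (i < nth 0 (transpose la) j) = (j < nth 0 la i).
Proof.
have geq_tr : transitive geq by move=> y x z /= le_yx le_zy; apply: leq_trans le_yx.
move=> la_dec.
have count_small p s : path geq p s -> p <= j -> count (ltn j) s = 0.
  move=> s_dec le_pj; apply/eqP; rewrite -leqn0 leqNgt -has_count.
  have /allP s_le := order_path_min geq_tr s_dec.
  by apply/hasPn=> q /s_le /= le_qp; rewrite -leqNgt (leq_trans le_qp).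
have [lt_j|le_j] := ltnP j (head 0 la).
  rewrite (nth_map 0) ?size_iota // nth_iota // add0n {lt_j}.
  elim: la i la_dec => [|p la IHla] [|i] //= la_dec; rewrite -?IHla ?(path_sorted la_dec) //;
    have [lt_jp|le_pj] := ltnP j p; rewrite //= ?(count_small p la la_dec le_pj) //.
rewrite nth_default ?size_map ?size_iota // ltn0.
apply/esym/negbTE; rewrite -leqNgt.
case: la la_dec le_j => [|p la] /= la_dec le_pj; first by rewrite nth_nil.
case: i => [//|i] /=; have [lt_i|?] := ltnP i (size la); last by rewrite nth_default.
have /allP la_le := order_path_min geq_tr la_dec.
exact: leq_trans (la_le _ (mem_nth 0 lt_i)) le_pj.
Qed.

(* 0-based (row, column) coordinates of the cells of the Young diagram. *)
Definition cell (la : seq nat) : finType :=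
  {c : 'I_(size la) * 'I_(head 0 la) | c.2 < nth 0 la c.1}.

Definition row_of (la : seq nat) (c : cell la) : nat := (val c).1.
Definition col_of (la : seq nat) (c : cell la) : nat := (val c).2.

Definition filling (la : seq nat) : finType := {ffun cell la -> 'I_(sumn la)}.

Definition entry (la : seq nat) (T : filling la) (c : cell la) : nat := (T c).+1.

Definition is_SYT (la : seq nat) (T : filling la) : bool :=
  [&& [forall k : 'I_(sumn la), #|[pred c | T c == k]| == 1],
      [forall c, forall d,
         (row_of c == row_of d) && (col_of c < col_of d) ==> (entry T c < entry T d)]
    & [forall c, forall d,
         (col_of c == col_of d) && (row_of c < row_of d) ==> (entry T c < entry T d)]].

Definition descents (la : seq nat) (T : filling la) : seq nat :=
  [seq i <- iota 1 (sumn la).-1 |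
    [exists c, exists d,
       [&& entry T c == i, entry T d == i.+1 & row_of c < row_of d]]].

Definition com (la : seq nat) (T : filling la) : seq nat :=
  comp_of_set (sumn la) (descents T).

Lemma descents_path (la : seq nat) (T : filling la) :
  0 < sumn la -> path ltn 0 (rcons (descents T) (sumn la)).
Proof.
move=> n_gt0; rewrite rcons_path; apply/andP; split.
  rewrite path_sortedE; last exact: ltn_trans.
  rewrite (sorted_filter ltn_trans) ?iota_ltn_sorted // andbT.
  by apply/allP=> i; rewrite mem_filter mem_iota => /and3P[].
rewrite /=; have: last 0 (descents T) \in 0 :: descents T by exact: mem_last.
rewrite inE => /predU1P[-> //|]; rewrite mem_filter mem_iota => /and3P[_ _].
by rewrite add1n prednK.
Qed.

Definition schur (la : seq nat) : series :=
  fun m => (\sum_(T : filling la | is_SYT T) fundamental (com T) m)%R.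

(* Main.v *)
Require Import Defs.
From mathcomp Require Import all_boot all_algebra finmap multiset zify.

Set Implicit Arguments.
Unset Strict Implicit.
Unset Printing Implicit Defensive.

(** The fundamental functions are linearly independent, so s_la is F-multiplicity
    free iff distinct SYT of shape la have distinct descent sets.  An SYT is the
    same thing as a Yamanouchi word of content la (the rows of its successive
    entries), whose ascents are the descents of the tableau.

    If two distinct words with the same descents end with the same letter, then so
    do their common extensions; hence every shape containing a shape with such a
    pair fails.  The minimal such shapes are (5,3), (4,2,1), (3,3,1), (3,2,2),
    (3,2,1,1) and (2,2,2,1,1); besides the listed shapes and their transposes, only
    (4,3), (3,2,1) and (2,2,2,1) contain none of them, and these have a pair of
    words ending with different letters. *)

(** * Yamanouchi words and their descents *)

Lemma geq_trans : transitive geq.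
Proof. by move=> y x z /= le_yx le_zy; apply: leq_trans le_yx. Qed.

Lemma nth_geq (la : seq nat) i j : sorted geq la -> i <= j -> nth 0 la j <= nth 0 la i.
Proof.
move=> la_dec le_ij; have [lt_j|?] := ltnP j (size la); last by rewrite nth_default.
by apply: (sorted_leq_nth geq_trans leqnn) => //; rewrite inE ?(leq_ltn_trans le_ij).
Qed.

(* A standard Young tableau is read as the word listing the rows of n, n-1, ..., 1
   in this order; all words below are thus read from the last letter on. *)
Fixpoint yam (w : seq nat) : bool :=
  if w is x :: v then ((x == 0) || (count_mem x v < count_mem x.-1 v)) && yam v
  else true.

(** The descent set as a bit list running from n - 1 down to 1: [y < x] says that the later of two
    successive entries lies strictly lower. *)
Fixpoint des (w : seq nat) : seq bool :=
  if w is x :: v then (if v is y :: _ then (y < x) :: des v else [::]) else [::].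

Definition content (w la : seq nat) : Prop :=
  forall i, count_mem i w = nth 0 la i.

Definition des_inj (la : seq nat) : Prop :=
  forall w w', yam w -> yam w' -> content w la -> content w' la ->
    des w = des w' -> w = w'.

Lemma des_cons2 x y v : des (x :: y :: v) = (y < x) :: des (y :: v).
Proof. by []. Qed.

Lemma yam_count w i j : yam w -> i <= j -> count_mem j w <= count_mem i w.
Proof.
move=> w_yam; elim: j => [|j IHj]; first by rewrite leqn0 => /eqP->.
rewrite leq_eqVlt => /predU1P[-> // | lt_ij]; apply: leq_trans (IHj lt_ij).
elim: w w_yam {IHj} => //= x v IHv /andP[x_ok /IHv{}IHv].
case: (x =P j.+1) x_ok => [->|_ _] /=; last by lia.
by rewrite gtn_eqF //=; lia.
Qed.

Lemma yam_mem_le w i j : yam w -> i <= j -> j \in w -> i \in w.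
Proof.
by move=> w_yam le_ij; rewrite -!has_pred1 !has_count => /leq_trans; apply; apply: yam_count.
Qed.

(** A letter new to [v] opens a row, and the letters of [v] form an initial segment, so only the
    first empty row is available. *)
Lemma yam_new_uniq v x y : yam (x :: v) -> yam (y :: v) ->
  x \notin v -> y \notin v -> 0 < x -> 0 < y -> x = y.
Proof.
wlog le_xy : x y / x <= y => [IH|].
  by case/orP: (leq_total x y) => le yx yy nx ny px py; [|symmetry]; apply: IH.
move=> _ /= /andP[y_ok v_yam] nx _ x_gt0 y_gt0.
have [|lt_xy] := leqP y x; first by lia.
case/negP: nx; apply: (@yam_mem_le v _ y.-1) => //; first by rewrite -ltnS prednK.
by rewrite -has_pred1 has_count; move: y_ok; rewrite (gtn_eqF y_gt0); apply: leq_ltn_trans.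
Qed.

Lemma notin_count1 (x : nat) v : count_mem x (x :: v) <= 1 -> x \notin v.
Proof. by rewrite /= eqxx -has_pred1 has_count add1n ltnS -leqNgt. Qed.

Lemma count_behead (x : nat) v i m : count_mem i (x :: v) <= m -> count_mem i v <= m.
Proof. by apply: leq_trans; rewrite leq_addl. Qed.

(** * Shapes whose words are determined by their descents *)

(** By induction the tails agree. A positive first letter is new and so exceeds the next one,
    whereas 0 never does: the leading bit tells whether the first letter is 0, and two positive ones
    open the same row. *)
Lemma hook_words w w' : yam w -> yam w' ->
  (forall i, 0 < i -> count_mem i w <= 1) ->
  (forall i, 0 < i -> count_mem i w' <= 1) ->
  size w = size w' -> des w = des w' -> w = w'.
Proof.
elim: w w' => [|x v IHv] [|x' v'] // w_yam w'_yam cw cw' [sz_v] eq_des.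
have eq_v : v = v'.
  apply: IHv => //; try by [case/andP: w_yam | case/andP: w'_yam].
  - by move=> i /cw /count_behead.
  - by move=> i /cw' /count_behead.
  by case: v v' sz_v eq_des {w_yam w'_yam cw cw'} => [|y v] [|y' v'] //= _ [].
rewrite -{v'}eq_v in sz_v w'_yam cw' eq_des *; congr (_ :: _).
case: v w_yam w'_yam cw cw' eq_des {IHv sz_v} => [|y v].
  by rewrite /= !ltnn !orbF !andbT => /eqP-> /eqP->.
move=> w_yam w'_yam cw cw'; rewrite !des_cons2 => -[lt_y].
have new z : 0 < z -> yam (z :: y :: v) -> count_mem z (z :: y :: v) <= 1 -> y < z.
  move=> z_gt0 /andP[_ v_yam] /notin_count1 z_new; rewrite ltnNge; apply/negP=> le_zy.
  by case/negP: z_new; apply: (@yam_mem_le _ _ y) => //; rewrite mem_head.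
case: (posnP x) => [x0|x_gt0]; case: (posnP x') => [x'0|x'_gt0]; first by rewrite x0.
- by move: (new _ x'_gt0 w'_yam (cw' _ x'_gt0)); rewrite -lt_y x0.
- by move: (new _ x_gt0 w_yam (cw _ x_gt0)); rewrite lt_y x'0.
exact: (yam_new_uniq w_yam w'_yam (notin_count1 (cw _ x_gt0)) (notin_count1 (cw' _ x'_gt0))).
Qed.

(** The entry 1 lies in row 0, so some later step must go down to a positive row. *)
Lemma yam_has_des z i : yam z -> i \in z -> 0 < i -> true \in des z.
Proof.
elim: z i => //= x [|y v] IHv i /andP[x_ok v_yam]; rewrite !inE => i_in i_gt0.
  by move: x_ok; rewrite -(eqP i_in) gtn_eqF.
have [//|le_xy] := ltnP y x; rewrite /=.
case/orP: i_in => [/eqP i_x|i_in]; last by apply: (IHv i).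
by apply: (IHv y) => //; rewrite ?mem_head //; lia.
Qed.

Lemma zero_no_des z : all (pred1 0) z -> true \notin des z.
Proof.
by elim: z => //= x [|y v] IHv //= /and3P[/eqP-> /eqP y0 zv]; rewrite inE negb_or IHv //= y0 eqxx.
Qed.

(** Equal first letters reduce to the tails, which are hook words once a 1 is removed; different
    first letters are excluded by [diff]. *)
Lemma two_row_words w w' : yam w -> yam w' ->
  {in w, forall i, i < 2} -> {in w', forall i, i < 2} ->
  count_mem 1 w = 2 -> count_mem 1 w' = 2 ->
  size w = size w' -> des w = des w' -> w = w'.
Proof.
(* The leading bit is false, so [v'] starts with its only 1 and is followed by zeros, without
   further descent. But [v] without its first letter still contains a 1, hence has a descent. *)
have diff v v' : yam (0 :: v) -> yam (1 :: v') -> {in v, forall i, i < 2} ->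
    {in v', forall i, i < 2} -> count_mem 1 v = 2 -> count_mem 1 v' = 1 ->
    des (0 :: v) = des (1 :: v') -> False.
  case: v v' => [|y z] [|y' z'] // w_yam w'_yam lw lw' c1 c1'; rewrite !des_cons2 => -[y'1 eq_des].
  have {}y'1 : y' = 1 by have := lw' y' (mem_head _ _); lia.
  rewrite {}y'1 in w'_yam lw' c1' eq_des.
  have z'0 : all (pred1 0) z'.
    apply/allP=> i i_z' /=; have : i < 2 by apply: lw'; rewrite inE i_z' orbT.
    have : i != 1.
      by apply: contraL i_z' => /eqP->; rewrite -has_pred1 has_count; move: c1' => /=; lia.
    by lia.
  case: z' z'0 eq_des {w'_yam lw' c1'} => [|t' z'] z'0; first by case: z c1 {w_yam lw} => //=; lia.
  case: z w_yam c1 {lw} => [|t z] w_yam c1; first by [].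
  move=> /= -[_ eq_des]; have /negP := zero_no_des z'0; apply; rewrite /= -eq_des.
  apply: (@yam_has_des (t :: z) 1) => //; first by case/andP: w_yam => _ /andP[].
  by rewrite -has_pred1 has_count; move: c1 => /=; lia.
elim: w w' => [|x v IHv] [|x' v'] // w_yam w'_yam lw lw' c1 c1' [sz_v] eq_des.
have eq_des' : des v = des v'.
  by case: v v' sz_v eq_des {w_yam w'_yam lw lw' c1 c1' IHv} => [|y v] [|y' v'] //= _ [].
have /andP[_ v_yam] := w_yam; have /andP[_ v'_yam] := w'_yam.
have lv : {in v, forall i, i < 2} by move=> i i_v; apply: lw; rewrite inE i_v orbT.
have lv' : {in v', forall i, i < 2} by move=> i i_v; apply: lw'; rewrite inE i_v orbT.
have := lw' x' (mem_head _ _); have := lw x (mem_head _ _).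
have hook u : {in u, forall i, i < 2} -> count_mem 1 u = 1 -> forall i, 0 < i -> count_mem i u <= 1.
  move=> lu cu [|[|i]] // _; first by rewrite cu.
  by rewrite (count_memPn _) //; apply/negP=> /lu.
case: x x' w_yam w'_yam c1 c1' eq_des {lw lw'}
  => [|[|//]] [|[|//]] w_yam w'_yam /= [c1] [c1'] eq_des _ _.
- by rewrite (IHv v').
- by case: (diff v v').
- by case: (diff v' v).
by rewrite (hook_words v_yam v'_yam) //; apply: hook.
Qed.

Lemma yam_uniq_des z : yam z -> uniq z -> all id (des z).
Proof.
elim: z => [|x [|y v] IHv] // /andP[_ v_yam] /andP[x_new v_uniq].
rewrite des_cons2 /= -/(des (y :: v)) IHv // andbT.
rewrite ltnNge; apply: contra x_new => le_xy.
by apply: (@yam_mem_le _ _ y) => //; rewrite mem_head.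
Qed.

Lemma des_uniq z : all id (des z) -> uniq z.
Proof.
move=> z_des; apply: (@sorted_uniq _ (fun x y => y < x)).
  by move=> y x u /= lt_yx lt_uy; apply: ltn_trans lt_yx.
  by move=> x; rewrite /= ltnn.
by elim: z z_des => [|x [|y v] IHv] //= /andP[-> /IHv].
Qed.

Lemma two_col_words w w' : yam w -> yam w' ->
  count_mem 0 w = 2 -> count_mem 0 w' = 2 -> count_mem 1 w = 2 -> count_mem 1 w' = 2 ->
  (forall i, 1 < i -> count_mem i w <= 1) -> (forall i, 1 < i -> count_mem i w' <= 1) ->
  size w = size w' -> des w = des w' -> w = w'.
Proof.
(* The new letter [x] makes the leading bit true, so [v] starts with 0 and the rest of it has
   distinct letters, all descents. Then the rest of [v'] has distinct letters too, against the two
   0s and two 1s in [v']. *)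
have diff x v v' : yam (1 :: v) -> yam (x :: v') -> count_mem 0 v = 2 -> count_mem 1 v = 1 ->
    count_mem 0 v' = 2 -> count_mem 1 v' = 2 -> 1 < x ->
    (forall i, 1 < i -> count_mem i v <= 1) -> x \notin v' ->
    size v = size v' -> des (1 :: v) = des (x :: v') -> False.
  case: v v' => [|y z] [|y' z'] // /andP[_ v_yam] /andP[_ v'_yam] c0 c1 c0' c1' x_gt1 cw x_new [sz].
  have lt_y'x : y' < x.
    rewrite ltnNge; apply: contra x_new => le_xy'.
    by apply: (@yam_mem_le _ _ y') => //; rewrite mem_head.
  rewrite !des_cons2 lt_y'x => -[y0 eq_des].
  have {}y0 : y = 0 by lia.
  rewrite {}y0 in v_yam c0 c1 cw eq_des.
  have z_uniq : uniq z.
    apply: count_mem_uniq => i; case: (boolP (i \in z)) => [i_z|/count_memPn //].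
    apply/eqP; rewrite eqn_leq -has_count has_pred1 i_z andbT.
    case: i i_z => [|[|i]] _; [by rewrite -ltnS -c0 | by rewrite -[leqRHS]c1 | exact: (cw i.+2)].
  have := yam_uniq_des _ z_uniq; case/andP: v_yam => _ z_yam /(_ z_yam) z_des.
  have eq_z : des z = des z'.
    by case: z z' sz eq_des {c0 c1 c0' c1' cw x_new v'_yam z_uniq z_yam z_des}
      => [|t z] [|t' z'] //= _ [].
  have z'_uniq : uniq z' by apply: des_uniq; rewrite -eq_z.
  have := count_uniq_mem 0 z'_uniq; have := count_uniq_mem 1 z'_uniq.
  move: c0' c1' => /=; case: (0 \in z'); case: (1 \in z');
    case: y' {v'_yam x_new lt_y'x eq_des} => [|[|y']] /=; lia.
elim: w w' => [|x v IHv] [|x' v'] // w_yam w'_yam c0 c0' c1 c1' cw cw' [sz_v] eq_des.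
have eq_des' : des v = des v'.
  by case: v v' sz_v eq_des {w_yam w'_yam cw cw' c0 c0' c1 c1' IHv} => [|y v] [|y' v'] //= _ [].
have /andP[_ v_yam] := w_yam; have /andP[_ v'_yam] := w'_yam.
have cv i : 1 < i -> count_mem i v <= 1 by move=> /cw /count_behead.
have cv' i : 1 < i -> count_mem i v' <= 1 by move=> /cw' /count_behead.
have /= le10 := yam_count v_yam (leq0n 1); have /= le10' := yam_count v'_yam (leq0n 1).
(* A first letter 0 would leave two 1s and a single 0 in the tail. After a first letter 1 the tail
   is a hook word. *)
case: x x' w_yam w'_yam c0 c0' c1 c1' eq_des cw cw' => [|[|x]] [|[|x']] w_yam w'_yam /=;
  rewrite ?add0n ?add1n => c0 c0' c1 c1' eq_des cw cw'; try by lia.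
- rewrite (hook_words v_yam v'_yam) // => -[|[|i]] // _; [|exact: cv| |exact: cv'] => /=; lia.
- case: (diff x'.+2 v v') => //=; try by lia.
  by apply: notin_count1; apply: cw'.
- case: (diff x.+2 v' v) => //=; try by lia.
  by apply: notin_count1; apply: cw.
have eq_v : v = v' by apply: IHv.
rewrite -{}eq_v in w'_yam cw' *; congr (_ :: _); 
by apply: (yam_new_uniq w_yam w'_yam) => //; apply: notin_count1; [apply: cw | apply: cw'].
Qed.

Lemma size_letters w k : {in w, forall i, i < k} -> size w = \sum_(i < k) count_mem (val i) w.
Proof.
elim: w => [|x v IHv] lw; first by rewrite big1.
rewrite /= big_split /= -IHv => [|i i_v]; last by apply: lw; rewrite inE i_v orbT.
have lt_xk := lw x (mem_head _ _); rewrite (bigD1 (Ordinal lt_xk)) //= eqxx big1 //.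
by move=> i /eqP ne_i; apply/eqP; rewrite eqb0; apply/eqP=> eq_xi; apply: ne_i; apply: val_inj.
Qed.

Lemma content_letters w la : content w la -> {in w, forall i, i < size la}.
Proof.
move=> cw i; rewrite -has_pred1 has_count cw [i < _]ltnNge; apply: contraL => le_i.
by rewrite nth_default.
Qed.

Lemma content_size w la : content w la -> size w = sumn la.
Proof.
move=> cw; rewrite (size_letters (content_letters cw)) sumnE (big_nth 0) big_mkord.
by apply: eq_bigr => i _; rewrite cw.
Qed.

(** * Enumeration of the words of a small shape *)

(** Tails of Yamanouchi words are Yamanouchi, so filtering at every length loses nothing and keeps
    the lists short enough to compute. *)
Fixpoint yam_words (k n : nat) : seq (seq nat) :=
  if n is n'.+1 then [seq w <- [seq x :: v | x <- iota 0 k, v <- yam_words k n'] | yam w]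
  else [:: [::]].

Lemma mem_yam_words k w : yam w -> {in w, forall i, i < k} -> w \in yam_words k (size w).
Proof.
elim: w => // x v IHv w_yam lw /=; rewrite mem_filter w_yam /=.
apply: allpairs_f; first by rewrite mem_iota lw ?mem_head.
by apply: IHv => [|i i_v]; [case/andP: w_yam | apply: lw; rewrite inE i_v orbT].
Qed.

Lemma uniq_map_inj (T U : eqType) (f : T -> U) s :
  uniq (map f s) -> {in s &, injective f}.
Proof.
elim: s => //= x s IHs /andP[fx_new fs_uniq] y z; rewrite !inE.
case/predU1P=> [->|y_s] /predU1P[->|z_s] // eq_f.
- by case/mapP: fx_new; exists z.
- by case/mapP: fx_new; exists y.
exact: IHs.
Qed.

Definition des_words (la : seq nat) : seq (seq bool) :=
  let k := size la in
  [seq des w | w <- yam_words k (sumn la) & [seq count_mem i w | i <- iota 0 k] == la].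

(** Turns the question for one concrete shape into a computation. *)
Lemma des_inj_small la : uniq (des_words la) -> des_inj la.
Proof.
move=> /uniq_map_inj inj w w' w_yam w'_yam cw cw'.
have mem u : yam u -> content u la ->
    u \in [seq w <- yam_words (size la) (sumn la)
             | [seq count_mem i w | i <- iota 0 (size la)] == la].
  move=> u_yam cu; rewrite mem_filter -(content_size cu) mem_yam_words ?andbT //.
    apply/eqP/(@eq_from_nth _ 0) => [|i]; rewrite size_map size_iota // => lt_i.
    by rewrite (nth_map 0) ?size_iota // nth_iota // cu.
  exact: content_letters.
by apply: inj; apply: mem.
Qed.

(** * Propagation of failure to larger shapes *)

Lemma des_catl p x u v : des (x :: u) = des (x :: v) ->
  des (p ++ x :: u) = des (p ++ x :: v).
Proof. by move=> eq_des; elim: p => [//|y [|z p] IHp]; congr (_ :: _). Qed.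

(* Rows are filled from the top: the first row that is still too short can always be extended. *)
Lemma yam_complete la w : sorted geq la -> (forall i, count_mem i w <= nth 0 la i) ->
  exists2 p, content (p ++ w) la &
    forall v, perm_eq v w -> yam v -> yam (p ++ v).
Proof.
move=> la_dec; have [m] := ubnP (\sum_(i < size la) (nth 0 la i - count_mem (val i) w)).
elim: m w => // m IHm w lt_m le_w.
have [/existsP ex_i|/existsPn all_i] := 
  boolP [exists i : 'I_(size la), count_mem (val i) w < nth 0 la i]; last first.
  exists [::] => //= i; apply/eqP; rewrite eqn_leq le_w leqNgt /=.
  have [lt_i|le_i] := ltnP i (size la); first exact: (all_i (Ordinal lt_i)).
  by rewrite (nth_default _ le_i).
have {ex_i} [i lt_i min_i] : exists2 i, count_mem i w < nth 0 la i &
    forall j, j < i -> count_mem j w = nth 0 la j.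
  have ex : exists i, count_mem i w < nth 0 la i by case: ex_i => i; exists (val i).
  case: (ex_minnP ex) => i lt_i min_i; exists i => // j lt_ji; apply/eqP.
  by rewrite eqn_leq le_w leqNgt; apply: contraL lt_ji => /min_i; rewrite -leqNgt.
(* Row i - 1 is full, hence longer than row i is so far. The test reads only letter counts, so [i]
   may precede every rearrangement of [w]. *)
have add_i v : perm_eq v w -> yam v -> yam (i :: v).
  move=> /permP eq_vw v_yam; rewrite /= v_yam andbT.
  case: i lt_i min_i => //= i lt_i min_i; rewrite !eq_vw (min_i i) //.
  by apply: leq_trans lt_i _; apply: nth_geq.
have lt_sz : i < size la by rewrite ltnNge; apply: contraL lt_i => ?; rewrite nth_default.
case: (IHm (i :: w)) => [|j|p cp yp].
- rewrite (bigD1 (Ordinal lt_sz)) //= in lt_m; rewrite (bigD1 (Ordinal lt_sz)) //= eqxx.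
  rewrite (eq_bigr (fun j : 'I_(size la) => nth 0 la j - count_mem (val j) w)).
    by move: lt_i => /=; lia.
  move=> j ne_ji; suff -> : (i == j :> nat) = false by rewrite add0n.
  by apply: contraNF ne_ji => /eqP eq_ij; apply/eqP/val_inj.
- by rewrite /=; case: eqP => [<-|_] //=; rewrite add0n.
exists (rcons p i); first by rewrite cat_rcons.
by move=> v eq_vw v_yam; rewrite cat_rcons; apply: yp; [rewrite perm_cons | apply: add_i].
Qed.

(* The largest entry lies in row [x] in both tableaux, so further entries create
   the same descents. *)
Lemma twins_extend x u v la : yam (x :: u) -> yam (x :: v) -> perm_eq u v ->
  des (x :: u) = des (x :: v) -> u != v -> sorted geq la ->
  (forall i, count_mem i (x :: u) <= nth 0 la i) -> ~ des_inj la.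
Proof.
move=> u_yam v_yam eq_uv eq_des /eqP ne_uv la_dec le_u inj; apply: ne_uv.
have [p cp yp] := yam_complete la_dec le_u.
have pv : perm_eq (x :: v) (x :: u) by rewrite perm_cons perm_sym.
have: p ++ x :: u = p ++ x :: v.
  apply: inj; [exact: yp | exact: yp | exact: cp | | exact: des_catl].
  by move=> i; rewrite -cp; apply: permP; rewrite perm_cat2l.
by move/eqP; rewrite eqseq_cat // => /andP[_ /eqP[]].
Qed.

(** * Classification of the shapes *)

Lemma ltn_ext (a b : nat) : (forall k, (k < a) = (k < b)) -> a = b.
Proof.
move=> eq_ab; apply/eqP; rewrite eqn_leq leqNgt eq_ab ltnn /=.
by rewrite leqNgt -eq_ab ltnn.
Qed.

(** Stated entrywise, since trailing zeros of [la] do not survive two transpositions. *)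
Lemma nth_transposeK la : sorted geq la -> sorted geq (transpose la) ->
  forall i, nth 0 (transpose (transpose la)) i = nth 0 la i.
Proof.
by move=> la_dec mu_dec i; apply: ltn_ext => k; rewrite !transpose_diagram.
Qed.

Lemma des_inj_hook la : (forall i, 0 < i -> nth 0 la i <= 1) -> des_inj la.
Proof.
move=> hook w w' w_yam w'_yam cw cw'; apply: hook_words => //.
- by move=> i i_gt0; rewrite cw hook.
- by move=> i i_gt0; rewrite cw' hook.
by rewrite (content_size cw) (content_size cw').
Qed.

Lemma des_inj_two_row a : des_inj [:: a; 2].
Proof.
move=> w w' w_yam w'_yam cw cw'; apply: two_row_words => //.
- exact: content_letters cw.
- exact: content_letters cw'.
by rewrite (content_size cw) (content_size cw').
Qed.

Lemma des_inj_two_col la : nth 0 la 0 = 2 -> nth 0 la 1 = 2 ->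
  (forall i, 1 < i -> nth 0 la i <= 1) -> des_inj la.
Proof.
move=> la0 la1 la_le w w' w_yam w'_yam cw cw'; apply: two_col_words => //;
  rewrite ?cw ?cw' //.
- by move=> i i_gt1; rewrite cw la_le.
- by move=> i i_gt1; rewrite cw' la_le.
by rewrite (content_size cw) (content_size cw').
Qed.

Lemma des_inj_eq la mu : (forall i, nth 0 la i = nth 0 mu i) -> des_inj la -> des_inj mu.
Proof.
by move=> eq_nth inj w w' w_yam w'_yam cw cw'; apply: inj => // i; rewrite eq_nth.
Qed.

Lemma sorted_ones l : path geq 1 l -> all (leq 1) l -> l = nseq (size l) 1.
Proof.
elim: l => //= x l IHl /andP[le_x1 l_dec] /andP[x_gt0 l_pos].
have x1 : x = 1 by move: le_x1 => /=; lia.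
by rewrite {1}IHl -?x1 // x1.
Qed.

Definition exceptional (n : nat) (mu : seq nat) : Prop :=
  [\/ n = 6 /\ mu = [:: 3; 3],
      n = 8 /\ mu = [:: 4; 4],
      4 <= n /\ mu = [:: n - 2; 2]
    | exists2 k : nat, 0 <= k <= n - 1 & mu = n - k :: nseq k 1].

Lemma nth_hook_le1 a k i : 0 < i -> nth 0 (a :: nseq k 1) i <= 1.
Proof. by case: i => // i _; rewrite /= nth_nseq; case: ifP. Qed.

Lemma exceptional_des_inj n la : sorted geq la -> exceptional n la -> des_inj la.
Proof.
move=> la_dec [[_ ->]|[_ ->]|[_ ->]|[k _ ->]].
- by apply: des_inj_small; vm_compute.
- by apply: des_inj_small; vm_compute.
- exact: des_inj_two_row.
by apply: des_inj_hook => i; apply: nth_hook_le1.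
Qed.

Lemma exceptional_transpose_des_inj n la : sorted geq la ->
  exceptional n (transpose la) -> des_inj la.
Proof.
move=> la_dec; have tr i j := transpose_diagram i j la_dec.
case=> [[_ mu]|[_ mu]|[n_ge4 mu]|[k _ mu]].
- apply: des_inj_eq (nth_transposeK la_dec _) _; rewrite mu //.
  by apply: des_inj_small; vm_compute.
- apply: des_inj_eq (nth_transposeK la_dec _) _; rewrite mu //.
  by apply: des_inj_small; vm_compute.
- apply: des_inj_two_col => [||i i_gt1].
  + by apply: ltn_ext => -[|[|j]]; rewrite -tr mu //= ?nth_nil //; lia.
  + by apply: ltn_ext => -[|[|j]]; rewrite -tr mu //= ?nth_nil //; lia.
  by rewrite leqNgt -tr mu /= -leqNgt.
apply: des_inj_hook => i i_gt0; rewrite leqNgt -tr mu -leqNgt.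
exact: leq_trans (nth_hook_le1 _ _ _) i_gt0.
Qed.

Lemma transpose_two_col k : transpose (2 :: 2 :: nseq k 1) = [:: k.+2; 2].
Proof.
by rewrite /transpose /= !count_nseq /= mul1n mul0n.
Qed.

Lemma not_des_inj w w' la : yam w -> yam w' -> w != w' -> des w = des w' ->
  content w la -> content w' la -> ~ des_inj la.
Proof. by move=> w_yam w'_yam /eqP ne_ww' eq_des cw cw' inj; apply/ne_ww'/inj. Qed.

Lemma two_row_exceptional a b : b <= a -> 0 < b -> des_inj [:: a; b] ->
  exceptional (a + b) [:: a; b].
Proof.
case: b => [|[|[|b]]] // le_ba _ inj.
- by constructor 4; exists 1; rewrite /=; [lia | congr [:: _; _]; lia].
- by constructor 3; split; [lia | congr [:: _; _]; lia].
case: a => [|[|[|[|[|a]]]]] // in le_ba inj *.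
- by case: b {inj} le_ba => // _; constructor 1.
- case: b => [|[|b]] // in le_ba inj *; last by constructor 2.
  (* Rows 1 2 4 5 / 3 6 7 and 1 2 5 7 / 3 4 6: both tableaux have descent set {2, 5}. *)
  by exfalso; move: inj;
  apply: (@not_des_inj [:: 1; 1; 0; 0; 1; 0; 0] [:: 0; 1; 0; 1; 1; 0; 0]) => // -[|[|i]] //=; rewrite nth_nil.
(* With 8 added to the first row of both, the same pair has shape (5,3), which every remaining shape
   contains. *)
by exfalso; move: inj;
  apply: (@twins_extend 0 [:: 1; 1; 0; 0; 1; 0; 0] [:: 0; 1; 0; 1; 1; 0; 0]) => //= [|[|[|i]]] //=; rewrite andbT.
Qed.

(** The shape contains (3,2,1). The tableaux 1 3 5 / 2 4 / 6 and 1 3 5 / 2 6 / 4 share the descent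
    set {1, 3, 5}, and their descents still agree when 7 is put in row 0, 1 or 3 of both, counting
    from 0. *)
Lemma fat_not_des_inj a b c l : 2 < a -> 1 < b -> 0 < c ->
  sorted geq (a :: b :: c :: l) -> all (leq 1) l -> ~ des_inj (a :: b :: c :: l).
Proof.
case: a b c => [|[|[|a]]] [|[|b]] [|c] // _ _ _ la_dec l_pos.
case: a => [|a] in la_dec *; last first.
  by apply: (@twins_extend 0 [:: 2; 0; 1; 0; 1; 0] [:: 1; 0; 2; 0; 1; 0]) => // -[|[|[|i]]].
case: b => [|b] in la_dec *; last first.
  by apply: (@twins_extend 1 [:: 2; 0; 1; 0; 1; 0] [:: 1; 0; 2; 0; 1; 0]) => // -[|[|[|i]]].
case: c => [|c] in la_dec *; last first.
  (* In row 2 the entry 7 would make 6 a descent of only one of the two tableaux, so (3,2,2) needs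
     another pair, with descent set {2, 4, 6}. *)
  by apply: (@twins_extend 2 [:: 1; 2; 0; 1; 0; 0] [:: 0; 2; 1; 1; 0; 0]) => // -[|[|[|i]]].
case: l => [|[|d] l] // in la_dec l_pos *; last first.
  by apply: (@twins_extend 3 [:: 2; 0; 1; 0; 1; 0] [:: 1; 0; 2; 0; 1; 0]) => // -[|[|[|[|i]]]].
by apply: (@not_des_inj [:: 2; 0; 1; 0; 1; 0] [:: 1; 0; 2; 0; 1; 0]) => // -[|[|[|i]]] //=;
  rewrite nth_nil.
Qed.

Lemma hook_exceptional a k : 0 < a -> exceptional (a + k) (a :: nseq k 1).
Proof. by constructor 4; exists k; [lia | rewrite addnK]. Qed.

Lemma sumn_nseq1 k : sumn (nseq k 1) = k.
Proof. by rewrite sumn_nseq mul1n. Qed.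

Lemma thin_exceptional c l : 0 < c -> sorted geq (2 :: 2 :: c :: l) -> all (leq 1) l ->
  des_inj (2 :: 2 :: c :: l) ->
  exceptional (4 + c + sumn l) (transpose (2 :: 2 :: c :: l)).
Proof.
case: c => [|[|[|c]]] // _ la_dec l_pos inj.
  have {}la_dec : path geq 1 l by case/and3P: la_dec.
  rewrite (sorted_ones la_dec l_pos) (transpose_two_col (size l).+1) sumn_nseq1.
  by constructor 3; split; [lia | congr [:: _; _]; lia].
case: l => [|[|d] l] // in la_dec l_pos inj *; first by constructor 1.
case: l => [|[|e] l] // in la_dec l_pos inj *; last first.
  (* The transposes 1 3 / 2 4 / 5 6 / 7 and 1 3 / 2 6 / 4 7 / 5 of the pair for (4,3) have descent
     set {1, 3, 4, 6}; here 8 forms a fifth row of both. *)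
  by exfalso; move: inj;
  apply: (@twins_extend 4 [:: 3; 2; 2; 1; 0; 1; 0] [:: 2; 1; 3; 2; 0; 1; 0]) => // -[|[|[|[|[|i]]]]].
case: d => [|[|d]] // in la_dec l_pos inj *; last by constructor 2.
by exfalso; move: inj;
  apply: (@not_des_inj [:: 3; 2; 2; 1; 0; 1; 0] [:: 2; 1; 3; 2; 0; 1; 0]) => // -[|[|[|[|i]]]] //=; rewrite nth_nil.
Qed.

Lemma des_inj_exceptional n la : 0 < n -> is_partition_of n la -> des_inj la ->
  exists2 mu, mu = la \/ mu = transpose la & exceptional n mu.
Proof.
move=> n_gt0 /and3P[la_dec la_pos /eqP n_la] inj.
case: la => [|a [|b [|c l]]] in la_dec la_pos n_la inj *.
- by rewrite -n_la in n_gt0.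
- by exists [:: a]; [left | rewrite -n_la /=; apply: (@hook_exceptional a 0); case/andP: la_pos].
- exists [:: a; b]; first by left.
  rewrite -n_la /= addn0; case/andP: la_dec => le_ba _; case/and3P: la_pos => _ b_gt0 _.
  exact: two_row_exceptional.
case/and4P: (la_pos) => a_gt0 b_gt0 c_gt0 l_pos.
have /and3P[/= le_ba le_cb l_dec] := la_dec.
have [b_le1|b_gt1] := leqP b 1.
  exists (a :: b :: c :: l); first by left.
  have tail1 : b :: c :: l = nseq (size l).+2 1.
    have b1 : b = 1 by lia.
    apply: (@sorted_ones [:: b, c & l]); last by case/andP: la_pos.
    by rewrite /= b1 /= -b1 le_cb.
  rewrite -n_la -[sumn _]/(a + sumn [:: b, c & l]) tail1 sumn_nseq1.
  exact: hook_exceptional.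
have [a_gt2|a_le2] := ltnP 2 a.
  by case: (fat_not_des_inj a_gt2 b_gt1 c_gt0 la_dec l_pos).
have [a2 b2] : a = 2 /\ b = 2 by lia.
rewrite {}a2 {}b2 in la_dec n_la inj *.
exists (transpose (2 :: 2 :: c :: l)); first by right.
rewrite -n_la /= (_ : 2 + _ = 4 + c + sumn l); last by lia.
exact: thin_exceptional.
Qed.

(** * Tableaux as words *)

Lemma cell_inj la (c d : cell la) : row_of c = row_of d -> col_of c = col_of d -> c = d.
Proof.
case: c d => [[r j] lt_j] [[r' j'] lt_j']; rewrite /row_of /col_of /= => eq_r eq_j.
by apply: val_inj; congr (_, _); apply: val_inj.
Qed.

Lemma col_lt la (c : cell la) : col_of c < nth 0 la (row_of c).
Proof. exact: valP c. Qed.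

Lemma cell_exists la r j : sorted geq la -> j < nth 0 la r ->
  exists2 c : cell la, row_of c = r & col_of c = j.
Proof.
move=> la_dec lt_j.
have lt_r : r < size la by rewrite ltnNge; apply: contraL lt_j => ?; rewrite nth_default.
have lt_h : j < head 0 la by rewrite -nth0; apply: leq_trans lt_j (nth_geq la_dec _).
by exists (Sub (Ordinal lt_r, Ordinal lt_h) lt_j).
Qed.

Lemma SYT_row la (T : filling la) c d : is_SYT T ->
  row_of c = row_of d -> col_of c < col_of d -> T c < T d.
Proof.
case/and3P=> _ /forallP/(_ c)/forallP/(_ d) + _ eq_r lt_c.
by rewrite eq_r eqxx lt_c.
Qed.

Lemma SYT_col la (T : filling la) c d : is_SYT T ->
  col_of c = col_of d -> row_of c < row_of d -> T c < T d.
Proof.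
case/and3P=> _ _ /forallP/(_ c)/forallP/(_ d) + eq_c lt_r.
by rewrite eq_c eqxx lt_r.
Qed.

Lemma SYT_inj la (T : filling la) : is_SYT T -> injective T.
Proof.
case/and3P=> /forallP T_bij _ _ c d eq_T.
have /card_le1_eqP T_one := eq_leq (eqP (T_bij (T c))).
by apply: T_one; rewrite inE // eq_T.
Qed.

Lemma SYT_surj la (T : filling la) k : is_SYT T -> k < sumn la ->
  exists c, T c = k :> nat.
Proof.
case/and3P=> /forallP T_bij _ _ lt_k.
have /card_gt0P[c] : 0 < #|[pred c | T c == Ordinal lt_k]| by rewrite (eqP (T_bij _)).
by rewrite inE => /eqP Tc; exists c; rewrite Tc.
Qed.

(** Here [k] stands for the entry k + 1, as the values of a filling start at 0. For an SYT and
    [k < sumn la] the default is not reached. *)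
Definition row_at la (T : filling la) (k : nat) : nat :=
  if [pick c | T c == k :> nat] is Some c then row_of c else 0.

Lemma row_atE la (T : filling la) c : is_SYT T -> row_at T (T c) = row_of c.
Proof.
move=> T_syt; rewrite /row_at; case: pickP => [d /eqP/val_inj/(SYT_inj T_syt)-> //|/(_ c)].
by rewrite eqxx.
Qed.

Definition row_word la (T : filling la) : seq nat := mkseq (row_at T) (sumn la).

(** For the row word of an SYT this is row [r] from left to right, with all entries lowered by
    one. *)
Definition positions (r : nat) (u : seq nat) : seq nat :=
  [seq k <- iota 0 (size u) | nth 0 u k == r].

Lemma sorted_positions r u : sorted ltn (positions r u).
Proof. by apply: (sorted_filter ltn_trans); apply: iota_ltn_sorted. Qed.

Lemma mem_positions r u k : (k \in positions r u) = (k < size u) && (nth 0 u k == r).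
Proof. by rewrite mem_filter mem_iota andbC. Qed.

Lemma count_positions r u m : m <= size u ->
  count_mem r (take m u) = count (gtn m) (positions r u).
Proof.
move=> le_m; rewrite /positions count_filter -(subnKC le_m) iotaD count_cat add0n.
rewrite [X in _ + X](_ : _ = 0) ?addn0; last first.
  apply/eqP; rewrite -leqn0 leqNgt -has_count; apply/hasPn=> k.
  by rewrite mem_iota /= => /andP[le_mk _]; rewrite ltnNge le_mk.
have -> : take m u = [seq nth 0 u k | k <- iota 0 m].
  apply: (@eq_from_nth _ 0) => [|k]; rewrite size_takel ?size_map ?size_iota // => lt_k.
  by rewrite nth_take // (nth_map 0) ?size_iota // nth_iota.
rewrite count_map; apply: eq_in_count => k.
by rewrite mem_iota /= => lt_k; rewrite lt_k.
Qed.

Lemma size_positions r u : size (positions r u) = count_mem r u.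
Proof.
rewrite -{2}(take_size u) count_positions // -(count_predT (positions r u)).
by apply: eq_in_count => k; rewrite mem_positions /= => /andP[-> _].
Qed.

(** Turns a bound on the j-th occurrence of a letter into a letter count of a prefix, to which the
    Yamanouchi property applies. *)
Lemma ltn_count_sorted s j m : sorted ltn s -> j < size s ->
  (j < count (gtn m) s) = (nth 0 s j < m).
Proof.
elim: s j => // x s IHs j xs_sorted lt_j.
have [lt_xm|le_mx] := ltnP x m.
  case: j lt_j => [|j] lt_j; rewrite /= lt_xm //= add1n ltnS.
  by apply: IHs => //; apply: path_sorted xs_sorted.
have /allP s_gt := order_path_min ltn_trans xs_sorted.
have all_ge y : y \in x :: s -> m <= y.
  by rewrite inE => /predU1P[-> //|/s_gt/ltnW]; apply: leq_trans.
rewrite [RHS]ltnNge all_ge ?mem_nth //; apply/negbTE.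
rewrite -leqNgt (leq_trans _ (leq0n j)) // leqn0 -leqn0 leqNgt -has_count.
by apply/hasPn=> y /all_ge; rewrite /= -leqNgt.
Qed.

Definition row_entry la (T : filling la) (r j : nat) : nat :=
  if [pick c | (row_of c == r) && (col_of c == j)] is Some c then T c else 0.

Lemma row_entryE la (T : filling la) c : row_entry T (row_of c) (col_of c) = T c.
Proof.
rewrite /row_entry; case: pickP => [d /andP[/eqP eq_r /eqP eq_c]|/(_ c)]; last by rewrite !eqxx.
by rewrite (cell_inj eq_r eq_c).
Qed.

(** Both lists are strictly increasing, so comparing members suffices. A tableau can thus be
    recovered from its word. *)
Lemma positions_row_word la (T : filling la) r : sorted geq la -> is_SYT T ->
  positions r (row_word T) = [seq row_entry T r j | j <- iota 0 (nth 0 la r)].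
Proof.
move=> la_dec T_syt; apply: (irr_sorted_eq ltn_trans ltnn); first exact: sorted_positions.
  apply: (@homo_sorted_in _ _ (gtn (nth 0 la r)) _ _ _ _ _ _ (iota_ltn_sorted _ _)); last first.
    by apply/allP=> j; rewrite mem_iota.
  move=> j k; rewrite !inE => lt_j lt_k lt_jk.
  have [c cr cj] := cell_exists la_dec lt_j; have [d dr dk] := cell_exists la_dec lt_k.
  rewrite -{1}cr -cj -dr -dk !row_entryE; apply: (SYT_row T_syt); first by rewrite cr.
  by rewrite cj dk.
move=> k; rewrite mem_positions size_mkseq; apply/andP/mapP => [[lt_k]|[j]].
  rewrite nth_mkseq // => /eqP; have [c <-] := SYT_surj T_syt lt_k.
  rewrite row_atE // => <-; exists (col_of c); last by rewrite row_entryE.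
  by rewrite mem_iota col_lt.
rewrite mem_iota => /(cell_exists la_dec)[c <- <-] ->.
by rewrite row_entryE nth_mkseq // row_atE.
Qed.

Lemma row_word_inj la (T T' : filling la) : sorted geq la -> is_SYT T -> is_SYT T' ->
  row_word T = row_word T' -> T = T'.
Proof.
move=> la_dec T_syt T'_syt eq_w; apply/ffunP=> c; apply: val_inj.
rewrite /= -!row_entryE.
have := positions_row_word (row_of c) la_dec T'_syt.
rewrite -eq_w positions_row_word // => /(congr1 (nth 0 ^~ (col_of c))).
by rewrite !(nth_map 0) ?size_iota ?col_lt // nth_iota ?col_lt.
Qed.

Lemma yam_catr p w : yam (p ++ w) -> yam w.
Proof. by elim: p => //= x p IHp /andP[_ /IHp]. Qed.

Lemma yam_revP u :
  (forall m r, m <= size u -> count_mem r.+1 (take m u) <= count_mem r (take m u)) <->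
  yam (rev u).
Proof.
split=> [|u_yam m r le_m]; last first.
  rewrite -2!(count_rev _ (take m u)); apply: yam_count => //.
  by apply: (@yam_catr (rev (drop m u))); rewrite -rev_cat cat_take_drop.
elim/last_ind: u => // u x IHu le_u; rewrite rev_rcons /= IHu => [|m r le_m]; last first.
  have := le_u m r; rewrite size_rcons -cats1 takel_cat //; apply.
  exact: leqW.
rewrite andbT !count_rev; case: x le_u => //= x /(_ (size u).+1 x).
rewrite -(size_rcons u x.+1) take_size -cats1 !count_cat /= => /(_ (leqnn _)).
by rewrite eqxx (gtn_eqF (ltnSn x)) !addn0 addn1.
Qed.

Definition word la (T : filling la) : seq nat := rev (row_word T).

Lemma content_word la (T : filling la) : sorted geq la -> is_SYT T -> content (word T) la.
Proof.
move=> la_dec T_syt i; rewrite count_rev -size_positions positions_row_word //.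
by rewrite size_map size_iota.
Qed.

Lemma yam_word la (T : filling la) : sorted geq la -> is_SYT T -> yam (word T).
Proof.
move=> la_dec T_syt; apply/yam_revP=> m r le_m.
rewrite !count_positions // !positions_row_word // !count_map.
have le_r : nth 0 la r.+1 <= nth 0 la r by apply: nth_geq.
(* Only the columns that row r + 1 reaches are needed: each entry of that row counted on the left
   has a smaller one above it. *)
rewrite -[nth 0 la r](subnKC le_r) iotaD count_cat; apply: leq_trans (leq_addr _ _).
rewrite -!size_filter; apply: uniq_leq_size; first by rewrite filter_uniq ?iota_uniq.
move=> j; rewrite !mem_filter /= => /andP[lt_m j_in]; rewrite j_in andbT.
rewrite mem_iota in j_in.
have [c cr cj] := cell_exists la_dec j_in.
have [d dr dj] := cell_exists la_dec (leq_trans j_in le_r).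
have : T d < T c by apply: (SYT_col T_syt); rewrite ?cj ?dj // cr dr.
by rewrite -!row_entryE cr cj dr dj => /ltn_trans; apply.
Qed.

(** The cell in row r and column j receives the position of the j-th occurrence of r in the reversed
    word; the Yamanouchi property makes the columns increase. *)
Lemma tableau_of_word la w : sorted geq la -> yam w -> content w la ->
  exists2 T : filling la, is_SYT T & word T = w.
Proof.
move=> la_dec; rewrite -(revK w); move: {w}(rev w) => u u_yam cu.
have {}cu i : count_mem i u = nth 0 la i by rewrite -cu count_rev.
have sz_u : size u = sumn la by apply: content_size.
have mem_pos (c : cell la) : nth 0 (positions (row_of c) u) (col_of c) \in positions (row_of c) u.
  by apply: mem_nth; rewrite size_positions cu col_lt.
have lt_pos (c : cell la) : nth 0 (positions (row_of c) u) (col_of c) < sumn la.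
  by have := mem_pos c; rewrite mem_positions sz_u => /andP[].
pose T : filling la := [ffun c => Ordinal (lt_pos c)].
have TE c : T c = nth 0 (positions (row_of c) u) (col_of c) :> nat by rewrite ffunE.
have uT c : nth 0 u (T c) = row_of c.
  by have := mem_pos c; rewrite mem_positions TE => /andP[_ /eqP].
have T_inj c d : T c = T d -> c = d.
  move=> eq_T; have eq_r : row_of c = row_of d by rewrite -!uT eq_T.
  apply: cell_inj => //; have := congr1 val eq_T; rewrite /= !TE -eq_r => /eqP.
  have := sorted_uniq ltn_trans ltnn (sorted_positions (row_of c) u) => pos_uniq.
  by rewrite nth_uniq ?size_positions ?cu ?col_lt // ?eq_r ?col_lt // => /eqP.
have T_syt : is_SYT T.
  apply/and3P; split.
  - apply/forallP=> k.
    have k_pos : val k \in positions (nth 0 u k) u by rewrite mem_positions sz_u ltn_ord eqxx.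
    have lt_j : index (val k) (positions (nth 0 u k) u) < nth 0 la (nth 0 u k).
      by rewrite -cu -size_positions index_mem.
    have [c cr cj] := cell_exists la_dec lt_j.
    have Tc : T c = k by apply: val_inj; rewrite /= TE cr cj nth_index.
    apply/eqP/(@eq_card1 _ c) => d; rewrite !inE -Tc; apply/eqP/eqP => [/T_inj //|->//].
  - apply/forallP=> c; apply/forallP=> d; apply/implyP=> /andP[/eqP eq_r lt_c].
    rewrite /entry ltnS !TE eq_r.
    apply: (sorted_ltn_nth ltn_trans _ (sorted_positions _ _)) => //;
      by rewrite inE size_positions cu ?col_lt // -eq_r col_lt.
  apply/forallP=> c; apply/forallP=> d; apply/implyP=> /andP[/eqP eq_c lt_r].
  rewrite /entry ltnS.
  rewrite ltn_neqAle; apply/andP; split.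
    by apply: contraL lt_r => /eqP/val_inj/T_inj->; rewrite ltnn.
  (* Up to position [T d] the letter [row_of d] occurs more than [col_of d] times, hence so does the
     smaller letter [row_of c], and [T c] comes no later. *)
  have le_m : (T d).+1 <= size u by rewrite sz_u ltn_ord.
  have lt_j : col_of d < count (gtn (T d).+1) (positions (row_of d) u).
    by rewrite ltn_count_sorted ?sorted_positions ?size_positions ?cu ?col_lt // -TE.
  rewrite -ltnS [val (T c)]TE.
  rewrite -ltn_count_sorted ?sorted_positions ?size_positions ?cu ?col_lt // eq_c.
  apply: leq_trans lt_j _; rewrite -!count_positions // -2!(count_rev _ (take _ u)).
  apply: yam_count; last exact: ltnW.
  by apply: (@yam_catr (rev (drop (T d).+1 u))); rewrite -rev_cat cat_take_drop.
exists T => //; congr rev; apply: (@eq_from_nth _ 0); rewrite size_mkseq ?sz_u // => k lt_k.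
rewrite nth_mkseq //; have [c <-] := SYT_surj T_syt lt_k.
by rewrite row_atE // uT.
Qed.

(** * Descents of a tableau and of its word *)

Lemma size_des w : size (des w) = (size w).-1.
Proof. by elim: w => [|x [|y v] IHv] //; rewrite des_cons2 /= IHv. Qed.

Lemma nth_des w k : k.+1 < size w -> nth false (des w) k = (nth 0 w k.+1 < nth 0 w k).
Proof. by elim: w k => [|x [|y v] IHv] [|k] //= lt_k; apply: IHv. Qed.

Lemma descentsE la (T : filling la) : is_SYT T ->
  descents T = [seq i <- iota 1 (sumn la).-1 | row_at T i.-1 < row_at T i].
Proof.
move=> T_syt; apply: eq_in_filter => -[|i]; rewrite mem_iota // add1n => /= lt_i.
have {}lt_i : i.+1 < sumn la by lia.
have [c Tc] := SYT_surj T_syt (ltnW lt_i); have [d Td] := SYT_surj T_syt lt_i.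
have -> : row_at T i = row_of c by rewrite -Tc row_atE.
have -> : row_at T i.+1 = row_of d by rewrite -Td row_atE.
apply/existsP/idP => [[c'] /existsP[d'] /and3P[] | lt_r].
  rewrite /entry !eqSS -Td => /eqP Tc' /eqP/val_inj/(SYT_inj T_syt)->.
  by rewrite (SYT_inj T_syt (val_inj (etrans Tc' (esym Tc)))).
by exists c; apply/existsP; exists d; rewrite /entry Tc Td !eqxx.
Qed.

Lemma eq_descents_des la (T T' : filling la) : is_SYT T -> is_SYT T' ->
  descents T = descents T' <-> des (word T) = des (word T').
Proof.
move=> T_syt T'_syt; rewrite !descentsE //.
have sz (U : filling la) : size (word U) = sumn la by rewrite size_rev size_mkseq.
have nth_word (U : filling la) k : k < sumn la -> nth 0 (word U) k = row_at U (sumn la - k.+1).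
  by move=> lt_k; rewrite nth_rev size_mkseq // nth_mkseq //; lia.
split=> [eq_D|eq_des].
  apply: (@eq_from_nth _ false) => [|k]; rewrite !size_des !sz // => lt_k.
  have lt_k1 : k.+1 < sumn la by lia.
  rewrite !nth_des ?sz // !nth_word //; try by lia.
  (* Letter k of the word is the row of the entry n - k, so bit k of [des] belongs to the possible
     descent n - k - 1. *)
  have i_in : sumn la - k.+1 \in iota 1 (sumn la).-1 by rewrite mem_iota; lia.
  have := congr1 (fun s => sumn la - k.+1 \in s) eq_D.
  by rewrite !mem_filter i_in !andbT -(subnS _ k.+1).
apply: eq_in_filter => i; rewrite mem_iota => i_in.
have := congr1 (nth false ^~ (sumn la - i.+1)) eq_des.
rewrite !nth_des ?sz; try by lia.
rewrite !nth_word; try by lia.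
by rewrite (_ : sumn la - (sumn la - i.+1).+2 = i.-1)
  1?(_ : sumn la - (sumn la - i.+1).+1 = i); lia.
Qed.

Lemma com_inj_des_inj la : sorted geq la -> 0 < sumn la ->
  {in [pred T : filling la | is_SYT T] &, injective (@com la)} <-> des_inj la.
Proof.
move=> la_dec n_gt0; split=> [inj w w' w_yam w'_yam cw cw' eq_des|inj T T'].
  have [T T_syt Tw] := tableau_of_word la_dec w_yam cw.
  have [T' T'_syt T'w'] := tableau_of_word la_dec w'_yam cw'.
  rewrite -Tw -T'w'; congr word; apply: inj => //; congr comp_of_set.
  by apply/eq_descents_des; rewrite // Tw T'w'.
rewrite !inE => T_syt T'_syt /(congr1 comp_set).
rewrite !comp_of_setK ?descents_path // => /eq_descents_des eq_D.
have eq_w : word T = word T'.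
  by apply: inj => //; [apply: yam_word | apply: yam_word | apply: content_word
    | apply: content_word | apply: eq_D].
by apply: (row_word_inj la_dec) => //; apply: (can_inj revK).
Qed.

(** * Linear independence of the fundamental functions *)

Lemma sumn_take_lt a i j : is_composition a -> i < j -> j <= size a ->
  sumn (take i a) < sumn (take j a).
Proof.
elim: a i j => [|x a IHa] i [|j] // /andP[x_gt0 a_comp] lt_ij lt_j.
case: i lt_ij => [|i] lt_ij /=; first by rewrite addn_gt0 x_gt0.
by rewrite ltn_add2l IHa.
Qed.

Lemma sorted_comp_set a : is_composition a -> sorted ltn (comp_set a).
Proof.
move=> a_comp.
apply: (@homo_sorted_in _ _ (fun i => i <= size a) _ _ _ _ _ _ (iota_ltn_sorted _ _)).
  by move=> i j _ le_j lt_ij; apply: sumn_take_lt.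
by apply/allP=> i; rewrite mem_iota; case: (size a) => [|k]; [case: i|rewrite /in_mem /=; lia].
Qed.

Lemma comp_set_bounds a j : is_composition a -> j \in comp_set a -> 0 < j < sumn a.
Proof.
move=> a_comp /mapP[i]; rewrite mem_iota => i_in ->.
have lt_i : i < size a by lia.
rewrite -{3}(take_size a) sumn_take_lt // andbT.
by have := @sumn_take_lt a 0 i a_comp; rewrite take0; apply; lia.
Qed.

Lemma sumn0_composition a : is_composition a -> sumn a = 0 -> a = [::].
Proof. by case: a => //= x a /andP[x_gt0 _]; lia. Qed.

(** The set lists the proper partial sums and the total is the last one; the parts are their
    differences. *)
Lemma comp_set_inj a b : is_composition a -> is_composition b ->
  sumn a = sumn b -> comp_set a = comp_set b -> a = b.
Proof.
move=> a_comp b_comp eq_s eq_D.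
have [a0|a_gt0] := posnP (size a).
  by rewrite (size0nil a0) in eq_s *; rewrite (sumn0_composition b_comp).
have [b0|b_gt0] := posnP (size b).
  by rewrite (size0nil b0) in eq_s *; rewrite (sumn0_composition a_comp).
have eq_sz : size a = size b.
  by have := congr1 size eq_D; rewrite !size_map !size_iota; lia.
have eq_take i : i <= size a -> sumn (take i a) = sumn (take i b).
  case: i => [|i] le_i; first by rewrite !take0.
  have [lt_i|ge_i] := ltnP i.+1 (size a); last by rewrite !take_oversize -?eq_sz.
  have := congr1 (nth 0 ^~ i) eq_D.
  by rewrite !(nth_map 0) ?size_iota ?nth_iota -?eq_sz ?add1n //; lia.
apply: (@eq_from_nth _ 0) => // i lt_i; apply/eqP.
rewrite -(eqn_add2l (sumn (take i a))) -sumn_rcons -take_nth //.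
by rewrite (eq_take i (ltnW lt_i)) -sumn_rcons -take_nth -?eq_sz // eq_take.
Qed.

(* The indices (1, ..., 1, 2, ..., 2, ...) of the monomial x_1^{a_1} x_2^{a_2} ... of F_a. *)
Definition staircase (a : seq nat) : seq nat :=
  [seq (count (geq k) (comp_set a)).+1 | k <- iota 0 (sumn a)].

Lemma size_staircase a : size (staircase a) = sumn a.
Proof. by rewrite size_map size_iota. Qed.

Lemma nth_staircase a k : k < sumn a ->
  nth 0 (staircase a) k = (count (geq k) (comp_set a)).+1.
Proof. by move=> lt_k; rewrite (nth_map 0) ?size_iota // nth_iota. Qed.

Lemma staircase_ascent a j : 0 < j < sumn a ->
  (nth 0 (staircase a) j.-1 < nth 0 (staircase a) j) = (j \in comp_set a).
Proof.
case/andP=> j_gt0 lt_j; rewrite !nth_staircase ?(leq_ltn_trans (leq_pred j)) // ltnS.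
have -> : count (geq j) (comp_set a) = count (geq j.-1) (comp_set a) + count_mem j (comp_set a).
  by elim: (comp_set a) => //= x s ->; lia.
by rewrite -[X in X < _]addn0 ltn_add2l -has_count has_pred1.
Qed.

Lemma sorted_staircase a : sorted leq (staircase a).
Proof.
apply: (@homo_sorted_in _ _ predT _ _ _ _ _ _ (iota_sorted 0 (sumn a))); last exact: all_predT.
move=> i j _ _ le_ij; rewrite ltnS; apply: sub_count => x /= le_xi.
exact: leq_trans le_ij.
Qed.

Lemma admissible_staircase a : is_composition a -> admissible a (staircase a).
Proof.
move=> a_comp; rewrite /admissible size_staircase eqxx sorted_staircase /=.
apply/andP; split; first by apply/allP=> x /mapP[k _ ->].
by apply/allP=> j j_a; rewrite staircase_ascent ?j_a // comp_set_bounds.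
Qed.

Lemma fundamental_staircase a : is_composition a ->
  fundamental a (seq_mset (staircase a)) <> 0%R.
Proof.
move=> a_comp [] /eqP; apply/negP; rewrite -lt0n -has_count; apply/hasP.
exists (staircase a); last exact: admissible_staircase.
by rewrite mem_permutations perm_sym perm_eq_seq_mset.
Qed.

(** The monomial has only one weakly increasing arrangement, the staircase of [a], which rises only
    at the elements of set(a). *)
Lemma fundamental_support a b : is_composition b ->
  fundamental b (seq_mset (staircase a)) <> 0%R ->
  sumn b = sumn a /\ {subset comp_set b <= comp_set a}.
Proof.
move=> b_comp F_neq0.
have /hasP[s] : has (admissible b) (permutations (seq_mset (staircase a))).
  by rewrite has_count lt0n; apply/eqP=> F0; apply: F_neq0; rewrite /fundamental F0.
rewrite mem_permutations => s_perm /and4P[/eqP sz_s _ s_sorted /allP s_asc].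
have eq_s : s = staircase a.
  apply: (sorted_eq leq_trans anti_leq) => //; first exact: sorted_staircase.
  by rewrite (perm_trans s_perm) // perm_eq_seq_mset.
have eq_sum : sumn b = sumn a by rewrite -sz_s eq_s size_staircase.
split=> // j j_b; have := s_asc j j_b; rewrite eq_s staircase_ascent //.
by rewrite -eq_sum comp_set_bounds.
Qed.

(* Triangularity: F_b meets the staircase monomial of a only if set(b) is contained in set(a). *)
Lemma fundamental_free (S : seq (seq nat)) (d : seq nat -> int) :
  uniq S -> all is_composition S ->
  (forall m, \sum_(a <- S) d a * fundamental a m = 0)%R ->
  {in S, forall a, d a = 0%R}.
Proof.
(* Induction on the number of parts: any other b in [S] whose F_b contains the staircase monomial of
   [a] has set(b) properly inside set(a), hence fewer parts and coefficient 0. *)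
move=> S_uniq /allP S_comp sum0 a; have [k] := ubnP (size a).
elim: k a => // k IHk a lt_a a_S; have a_comp := S_comp a a_S.
have := sum0 (seq_mset (staircase a)); rewrite (bigD1_seq a) //= big_seq_cond big1 => [|b].
  rewrite GRing.addr0 => /eqP; rewrite GRing.mulf_eq0 => /orP[/eqP //|/eqP].
  by move=> /(fundamental_staircase a_comp).
case/andP=> b_S /eqP ne_ba.
have [->|/eqP F_neq0] := eqVneq (fundamental b (seq_mset (staircase a))) 0%R.
  by rewrite GRing.mulr0.
have b_comp := S_comp b b_S; have [eq_sum sub_ba] := fundamental_support b_comp F_neq0.
rewrite (IHk b) ?GRing.mul0r //; apply: leq_trans (_ : size a <= k) => //.
rewrite ltnNge; apply/negP=> le_ab; apply: ne_ba; apply: comp_set_inj => //.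
have sorted_D c : is_composition c -> sorted ltn (comp_set c) by apply: sorted_comp_set.
apply: (irr_sorted_eq ltn_trans ltnn); rewrite ?sorted_D //.
have b_uniq := sorted_uniq ltn_trans ltnn (sorted_D b b_comp).
have [|_ //] := uniq_min_size b_uniq sub_ba.
by rewrite !size_map !size_iota -!subn1 leq_sub2r.
Qed.

(** * Multiplicity freeness as injectivity of [com] *)

Lemma com_composition la (T : filling la) : 0 < sumn la -> is_composition (com T).
Proof. by move=> n_gt0; apply/comp_of_set_composition/descents_path. Qed.

(** By linear independence the coefficient of F_a is the number of SYT with composition a, which is
    at most 1 for every a exactly when [com] is injective on SYT. *)
Lemma schur_multiplicity_free la : 0 < sumn la ->
  F_multiplicity_free (schur la) <->
  {in [pred T : filling la | is_SYT T] &, injective (@com la)}.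
Proof.
move=> n_gt0; pose s := [seq com T | T <- enum [pred T : filling la | is_SYT T]].
split=> [[c [c_comp c_schur c01]] T1 T2|inj]; last first.
  have s_uniq : uniq s.
    rewrite map_inj_in_uniq ?enum_uniq // => T T'; rewrite !mem_enum; exact: inj.
  pose A := [fset a in s]%fset.
  pose c : {fsfun seq nat -> int with 0%R} := [fsfun a in A => 1%R | 0%R].
  have cE a : c a = if a \in A then 1%R else 0%R by rewrite fsfunE.
  have suppE a : (a \in finsupp c) = (a \in s).
    by rewrite mem_finsupp cE inE /=; case: ifP.
  exists c; split=> [a|m|a].
  - by rewrite suppE => /mapP[T _ ->]; apply: com_composition.
  - rewrite /schur (perm_big s) /=; last by apply: uniq_perm; rewrite ?fset_uniq.
    rewrite big_map big_enum /=; apply: eq_big => [T|T T_syt]; first by rewrite inE.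
    by rewrite cE inE map_f ?mem_enum // GRing.mul1r.
  by rewrite cE; case: ifP; [right|left].
rewrite !inE => T1_syt T2_syt eq_com; apply/eqP/negPn/negP => ne_T.
(* A common index set for the given expansion and the one by tableaux, so that their difference is a
   single vanishing sum. *)
pose S := undup (finsupp c ++ s).
pose mult a : int := (\sum_(T : filling la | is_SYT T) (com T == a)%:R)%R.
have S_comp : all is_composition S.
  apply/allP=> a; rewrite mem_undup mem_cat => /orP[/c_comp //|/mapP[T _ ->]].
  exact: com_composition.
have com_S (T : filling la) : is_SYT T -> com T \in S.
  by move=> T_syt; rewrite mem_undup mem_cat (map_f (@com la)) ?orbT ?mem_enum.
have sum0 m : (\sum_(a <- S) (c a - mult a) * fundamental a m = 0)%R.
  under eq_bigr do rewrite GRing.mulrBl; rewrite GRing.sumrB.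
  rewrite (bigID (fun a => a \in finsupp c)) /= [X in (_ + X - _)%R]big1 => [|a]; last first.
    by move=> /fsfun_dflt->; rewrite GRing.mul0r.
  rewrite GRing.addr0 -big_filter (perm_big (finsupp c)) /=; last first.
    apply: uniq_perm; rewrite ?filter_uniq ?undup_uniq // => a.
    by rewrite mem_filter mem_undup mem_cat; case: (a \in finsupp c).
  rewrite -c_schur /schur; apply/eqP; rewrite GRing.subr_eq0; apply/eqP.
  under [RHS]eq_bigr do rewrite GRing.mulr_suml; rewrite exchange_big /=.
  apply: eq_bigr => T T_syt; rewrite (bigD1_seq (com T)) ?com_S ?undup_uniq //= eqxx GRing.mul1r.
  by rewrite big1 ?GRing.addr0 // => a; rewrite eq_sym => /negbTE->; rewrite GRing.mul0r.
have := fundamental_free (undup_uniq _) S_comp sum0 (com_S T1 T1_syt).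
move/eqP; rewrite GRing.subr_eq0 /mult (bigD1 T1) //= eqxx.
rewrite (bigD1 T2) /=; last by rewrite T2_syt eq_sym.
rewrite eq_com eqxx.
(* [T1] and [T2] contribute 1 each and the other tableaux [r], so the coefficient would be at least
   2. *)
set r := (X in (_ + (_ + X))%R); have r_ge0 : (0 <= r)%R by apply: Num.Theory.sumr_ge0.
by case: (c01 (com T2)) => ->; move: r_ge0; lia.
Qed.

Theorem theorem3p3 (n : nat) (la : seq nat) (n_gt0 : 0 < n)
    (la_part : is_partition_of n la) :
  F_multiplicity_free (schur la) <->
  exists2 mu : seq nat, mu = la \/ mu = transpose la &
    [\/ n = 6 /\ mu = [:: 3; 3],
        n = 8 /\ mu = [:: 4; 4],
        4 <= n /\ mu = [:: n - 2; 2]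
      | exists2 k : nat, 0 <= k <= n - 1 & mu = n - k :: nseq k 1].
Proof.
have /and3P[la_dec _ /eqP n_la] := la_part.
have la_gt0 : 0 < sumn la by rewrite n_la.
split=> [/(schur_multiplicity_free la_gt0)/(com_inj_des_inj la_dec la_gt0) inj|].
  exact: des_inj_exceptional inj.
case=> mu mu_la mu_exc; apply/(schur_multiplicity_free la_gt0)/(com_inj_des_inj la_dec la_gt0).
case: mu_la mu_exc => ->; first exact: exceptional_des_inj.
exact: exceptional_transpose_des_inj.
Qed.
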